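(* Let $d\geq 2$ be an integer. The competitive ratio of the \textsc{Ranking} algorithm for online bipartite matching on $d$-regular bipartite graphs is at most $$\gamma(d)=1-\frac{d-1}{2d-1}\cdot\left(1-\frac{1}{d}\right)^d .$$
   Context: Online bipartite matching: a bipartite graph $G=(S\cup R,E)$ has offline vertices $S$ (servers), known in advance, and online vertices $R$ (requests) that arrive one at a time in an adversarially chosen order. When a request $r$ arrives, its neighbor set $N(r)\subseteq S$ is revealed, and the algorithm must irrevocably either match $r$ to a currently unmatched neighbor or leave $r$ unmatched forever. $\mathsf{ALG}$ is the size of the matching produced and $\mathsf{OPT}$ the size of a maximum matching of $G$. The competitive ratio of a (possibly randomized) algorithm on a class of instances is the infimum over all instances in the class of $\mathbb{E}[\mathsf{ALG}]/\mathsf{OPT}$. A bipartite graph is $d$-regular if every server and every request has degree exactly $d$. The \textsc{Ranking} algorithm: each server $s$ independently draws a rank $y_s$ uniformly from $[0,1]$; each arriving request is matched to its unmatched neighbor with the smallest rank, if any unmatched neighbor exists. *)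

(* Defs.v *)
From HB Require Import structures.
From mathcomp Require Import all_boot all_order all_algebra.
From mathcomp Require Import all_classical all_reals all_analysis.
Set Implicit Arguments.
Unset Strict Implicit.
Unset Printing Implicit Defensive.
Import Order.TTheory GRing.Theory Num.Theory.
Local Open Scope ring_scope.

Record obm_instance := ObmInstance {
  server : finType;
  request : finType;
  adj : server -> request -> bool;
  arrival : seq request;
  arrival_perm : perm_eq arrival (enum request)
}.

Section Matching.
Variable I : obm_instance.

Definition neighbors (r : request I) : {set server I} := [set s | adj s r].

Definition is_matching (M : {set server I * request I}) : bool :=
  [forall e in M, adj e.1 e.2] &&
  [forall e in M, forall f in M, (e.1 == f.1) || (e.2 == f.2) ==> (e == f)].

Definition OPT : nat := \max_(M : {set server I * request I} | is_matching M) #|M|.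

Definition unmatched (M : {set server I * request I}) : {set server I} :=
  [set s | [forall r, (s, r) \notin M]].

Section Ranking.
Variables (R : realType) (y : server I -> R).

(* Ties among ranks, a null event, are broken by the enumeration of servers. *)
Definition min_rank (A : {set server I}) : option (server I) :=
  [pick s in A | [forall t in A, y s <= y t]].

Definition ranking_step (M : {set server I * request I}) (r : request I) :
    {set server I * request I} :=
  if min_rank (neighbors r :&: unmatched M) is Some s then (s, r) |: M else M.

Definition ranking : {set server I * request I} :=
  foldl ranking_step finset.set0 (arrival I).

End Ranking.
End Matching.

Definition regular (d : nat) (I : obm_instance) : Prop :=
  (forall s : server I, #|[set r | adj s r]| = d) /\
  (forall r : request I, #|neighbors r| = d).

Section IidUniform.
Local Open Scope classical_set_scope.
Variable R : realType.

Definition tuple_cons n (p : measurableTypeR R * n.-tuple (measurableTypeR R)) :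
  n.+1.-tuple (measurableTypeR R) := [tuple of p.1 :: p.2].

Lemma measurable_tuple_cons n : measurable_fun [set: _] (@tuple_cons n).
Proof. exact: measurable_cons. Qed.

HB.instance Definition _ n :=
  isMeasurableFun.Build _ _ _ _ (@tuple_cons n) (@measurable_tuple_cons n).

(* The joint law of n independent uniform ranks in [0, 1], i.e. the n-fold
   product of the uniform law; see iid_uniform_box. *)
Fixpoint iid_uniform n : probability (n.-tuple (measurableTypeR R)) R :=
  match n with
  | 0 => \d_ [tuple]
  | m.+1 => distribution
      (uniform_prob (@ltr01 R) \x iid_uniform m)%E (@tuple_cons m)
  end.

Lemma iid_uniform_box n (A : 'I_n -> set (measurableTypeR R)) :
  (forall i, measurable (A i)) ->
  iid_uniform n [set t | forall i, A i (tnth t i)] =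
  (\prod_(i < n) uniform_prob (@ltr01 R) (A i))%E.
Proof.
elim: n A => [|n IH] A mA /=.
  rewrite big_ord0 diracE mem_set// => -[]//.
rewrite /distribution /pushforward /= big_ord_recl.
rewrite -(IH (fun i => A (lift ord0 i))); last by move=> i; exact: mA.
rewrite -product_measure1E//; last first.
  rewrite (_ : [set t | _] =
    \bigcap_(i in [set: 'I_n]) ((fun t => tnth t i) @^-1` A (lift ord0 i))).
    apply: fin_bigcap_measurable => // i _.
    rewrite -[X in measurable X]setTI; exact: measurable_tnth.
  by apply/seteqP; split => t /= h i => [_|]; exact: h.
congr (_ _); apply/seteqP; split => -[x t] /=.
  move=> h; split => /=; first exact: (h ord0).
  by move=> i; have := h (lift ord0 i); rewrite tnthS.
move=> [/= hx ht] i; case: (unliftP ord0 i) => [j|] -> //.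
by rewrite tnthS; exact: ht.
Qed.

Definition rank_of (I : obm_instance)
    (t : #|server I|.-tuple (measurableTypeR R)) (s : server I) : R :=
  tnth t (enum_rank s).

Definition expected_ranking (I : obm_instance) : \bar R :=
  'E_(iid_uniform #|server I|)[fun t => #|ranking (rank_of t)|%:R].

(* EALG I is the expected size of the matching the algorithm produces on I.
   Instances with OPT I = 0, where the ratio is undefined, are excluded. *)
Definition competitive_ratio (EALG : obm_instance -> \bar R)
    (C : obm_instance -> Prop) : \bar R :=
  ereal_inf [set x | exists I : obm_instance,
    [/\ C I, (0 < OPT I)%N & x = (EALG I * ((OPT I)%:R^-1)%:E)%E]].

End IidUniform.
Arguments expected_ranking : clear implicits.

(* Main.v *)
(* With n = d - 1, take n "core" servers, d "private" servers p_0, ..., p_n, and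
   let the first d requests a_0, ..., a_n be such that a_i sees all the cores
   and p_i; n last requests see all the private servers. Reading the servers by
   increasing rank, RANKING on the first requests becomes an urn: a core takes
   the first free a_i, and p_i takes a_i if it is still free. With m cores and u
   free requests left, the expected number V(m, u) of cores that stay unmatched
   satisfies (m + u) V(m, u) = m V(m-1, u-1) + u V(m, u-1), and Bernoulli's
   inequality gives V(m, u) >= m (m / (m+1))^u by induction. Hence at least
   (d-1) (1 - 1/d)^d of the 2d-1 servers are unmatched on average.

   The orders of the ranks are reduced to counting by cutting [0, 1] into M
   cells: every order is realised by 'C(M, N) of the M^N equally likely boxes of
   the N = 2d-1 ranks, and 'C(M, N) / M^N tends to 1 / N! as M grows. *)
Require Import Defs.
From HB Require Import structures.
From mathcomp Require Import all_boot all_order all_algebra.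
From mathcomp Require Import all_classical all_reals all_analysis.
From mathcomp Require Import measurable_realfun ring lra.
Import Order.TTheory GRing.Theory Num.Theory.
Local Open Scope ring_scope.
Set Implicit Arguments.
Unset Strict Implicit.
Unset Printing Implicit Defensive.

(** * The urn recursion *)

Section Urn.
Variable R : realFieldType.

(** The claimed lower bound for V(m, u), exact at u = 0. *)
Definition core_bound (m u : nat) : R := m%:R * (m%:R / m.+1%:R) ^+ u.

Lemma bernoulli_le (x : R) (u : nat) : 0 <= x <= 1 -> 1 - u%:R * x <= (1 - x) ^+ u.
Proof.
move=> /andP[x0 x1]; elim: u => [|u IH]; first by rewrite mul0r subr0 expr0.
rewrite exprS; apply: (@le_trans _ _ ((1 - x) * (1 - u%:R * x))).
  have u0 : 0 <= u%:R :> R by [].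
  by rewrite -[in leLHS]natr1; nra.
by rewrite ler_wpM2l// subr_ge0.
Qed.

(** The ratio of (m-1)/m to m/(m+1) is 1 - 1/m^2. Once the common factor m (m/(m+1))^u is taken out,
    the only power left is (1 - 1/m^2)^u, and Bernoulli's inequality turns the claim into one
    between rational functions. *)
Lemma core_bound_urn (m u : nat) :
  (m + u.+1)%:R * core_bound m u.+1 <=
  m%:R * core_bound m.-1 u + u.+1%:R * core_bound m u.
Proof.
case: m => [|k]; first by rewrite /core_bound !mul0r !mulr0 addr0.
rewrite /core_bound /= -!natr1 natrD -!natr1.
have: 0 <= k%:R :> R by []; have: 0 <= u%:R :> R by [].
move: (k%:R) => x; move U: (u%:R) => y y0 x0.
rewrite [X in _ * (_ * X) <= _]exprS.
(* Here m = x + 1, so [q] is m/(m+1) and [z] is 1/m^2. *)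
set q := (x + 1) / (x + 1 + 1); set z := ((x + 1) ^+ 2)^-1.
have q0 : 0 <= q by rewrite divr_ge0//; lra.
have -> : x / (x + 1) = q * (1 - z).
  by rewrite /q /z; field; apply/andP; split; lra.
rewrite [(q * (1 - z)) ^+ u]exprMn.
have hz : 0 <= z <= 1.
  by rewrite /z invr_ge0 sqr_ge0/= invf_le1 ?exprn_ege1// ?exprn_gt0//; lra.
have := bernoulli_le u hz; rewrite U => hb.
have step : (x + 1 + (y + 1)) * q <= x * (1 - z) ^+ u + (y + 1).
  have : x * (1 - y * z) <= x * (1 - z) ^+ u by rewrite ler_wpM2l.
  suff : (x + 1 + (y + 1)) * q <= x * (1 - y * z) + (y + 1) by lra.
  rewrite -subr_ge0.
  have -> : x * (1 - y * z) + (y + 1) - (x + 1 + (y + 1)) * q =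
      y * z / (x + 1 + 1).
    by rewrite /q /z; field; apply/andP; split; lra.
  by rewrite divr_ge0 ?mulr_ge0//; lra.
have c0 : 0 <= (x + 1) * q ^+ u by rewrite mulr_ge0 ?exprn_ge0//; lra.
move: (ler_wpM2l c0 step); move: (q ^+ u) ((1 - z) ^+ u) => Q W. lra.
Qed.

End Urn.

(** * Greedy loss averaged over all server orders *)

(* [lossn o l] counts the servers [inl _] left unmatched when the servers pick
   requests greedily in the order [o]: a server [inl _] takes the first request
   of [l] still free, and [inr j] can only take request [j]. *)
Fixpoint lossn (A B : eqType) (o : seq (A + B)) (l : seq B) : nat :=
  match o with
  | [::] => 0
  | inl _ :: o' => if l is _ :: l' then lossn o' l' else (lossn o' l).+1
  | inr j :: o' => lossn o' (rem j l)
  end.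

Section Lossn.
Variables A B : eqType.
Implicit Types (o s : seq (A + B)) (l : seq B).

Definition is_core (x : A + B) : bool := if x is inl _ then true else false.

Definition live l (x : A + B) : bool := if x is inr j then j \in l else false.

Lemma lossn_nil o : lossn o [::] = count is_core o.
Proof. by elim: o => //= -[a|b] o -> /=. Qed.

(** With [lossn_cons_live], this exchanges server-by-server and request-by-request processing: [b]
    goes to the first server of the order that can take it, and the servers before it are private to
    other requests, so [b] may be settled first. *)
Lemma lossn_cons_core o1 o2 c b l :
  ~~ has is_core o1 -> inr b \notin o1 ->
  lossn (o1 ++ inl c :: o2) (b :: l) = lossn (o1 ++ o2) l.
Proof.
elim: o1 l => //= -[a|j] o1 IH l //= h1; rewrite inE negb_or => /andP[bj h2].
have -> : (b == j) = false by apply: contraNF bj => /eqP ->.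
by rewrite IH.
Qed.

(** The private server may stay in the order: once its request is gone it has no effect. *)
Lemma lossn_cons_live o1 o2 b l :
  ~~ has is_core o1 -> inr b \notin o1 -> b \notin l ->
  lossn (o1 ++ inr b :: o2) (b :: l) = lossn (o1 ++ inr b :: o2) l.
Proof.
elim: o1 l => //= [l _ _ bl|]; first by rewrite eqxx (rem_id bl).
move=> [a|j] o1 IH l //= h1; rewrite inE negb_or => /andP[bj h2] bl.
have -> : (b == j) = false by apply: contraNF bj => /eqP ->.
by rewrite IH//; apply: contra bl; exact: mem_rem.
Qed.

Lemma count_live s l : uniq s -> uniq l -> {subset map inr l <= s} ->
  count (live l) s = size l.
Proof.
move=> us ul sub; rewrite -(size_map (@inr A B) l) -size_filter.
apply: perm_size; apply: uniq_perm.
- exact: filter_uniq.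
- by rewrite map_inj_uniq// => x y [].
move=> x; rewrite mem_filter; apply/andP/idP => [[]|xl].
  by case: x => //= j jl _; exact: map_f.
by split; [case/mapP: xl => j jl ->|exact: sub].
Qed.

Lemma big_permutations (R : nmodType) (T : eqType) (F : seq T -> R) (s : seq T) :
  uniq s -> (0 < size s)%N ->
  \sum_(o <- permutations s) F o =
  \sum_(x <- s) \sum_(o <- permutations (rem x s)) F (x :: o).
Proof.
move=> us s0; rewrite (perm_big _ (permutationsE s0)) undup_id//=.
by rewrite big_allpairs_dep.
Qed.

Lemma sum_if_count (R : comNzRingType) (T : eqType) (P Q : pred T) (a b c : R)
    (s : seq T) : (forall x, P x -> ~~ Q x) ->
  \sum_(x <- s) (if P x then a else if Q x then b else c) =
  (count P s)%:R * a + (count Q s)%:R * b +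
  ((size s)%:R - (count P s)%:R - (count Q s)%:R) * c.
Proof.
move=> PQ; elim: s => [|x s IH].
  by rewrite big_nil /=; ring.
rewrite big_cons IH /= !natrD -[(size s).+1]addn1 natrD.
have := PQ x; case: (P x) => [/(_ isT)/negbTE ->|_]; last case: (Q x).
all: by rewrite /=; ring.
Qed.

(** Induction on the number of servers, splitting on the first one: a core leads from (m, u) to
    (m-1, u-1), a private server with free request to (m, u-1), any other to (m, u). The inclusion
    hypothesis says that every free request still has its private server ahead, so exactly u servers
    are of the second kind. *)
Lemma sum_lossn (R : realFieldType) s l :
  uniq s -> uniq l -> {subset map inr l <= s} ->
  (size s)`!%:R * core_bound R (count is_core s) (size l) <=
  \sum_(o <- permutations s) (lossn o l)%:R.
Proof.
move En: (size s) => n; elim: n s l En => [|n IH] s l En us ul sub.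
  move/size0nil: En => ?; subst s.
  by rewrite /core_bound /= !mul0r mulr0 sumr_ge0.
case: l ul sub => [|b l] ul sub.
  rewrite (eq_big_seq (fun=> (count is_core s)%:R)); last first.
    by move=> o; rewrite mem_permutations lossn_nil => /permP ->.
  by rewrite big_const_seq count_predT size_permutations// En iter_addr_0
    /core_bound /= expr0 mulr1 mulr_natl.
rewrite big_permutations ?En//; set m := count _ s; set u := size l.
set cb := core_bound R.
have bound x : x \in s -> n`!%:R * (if is_core x then cb m.-1 u else
    if live (b :: l) x then cb m u else cb m u.+1) <=
    \sum_(o <- permutations (rem x s)) (lossn (x :: o) (b :: l))%:R.
  move=> xs; have srem : size (rem x s) = n by rewrite size_rem// En.
  have urem : uniq (rem x s) by exact: rem_uniq.
  have crem : count is_core (rem x s) = (m - is_core x)%N.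
    by rewrite count_rem xs.
  have inrem z : z \in s -> z != x -> z \in rem x s.
    by move=> zs zx; rewrite (mem_rem_uniq x us) inE zx.
  case: x xs srem urem crem inrem => [c|j] xs srem urem crem inrem /=.
    have := IH (rem (inl c) s) l srem urem; rewrite crem subn1; apply.
      by case/andP: ul.
    move=> _ /mapP[k kl ->]; apply: inrem => //.
    by apply: sub; rewrite map_f// inE kl orbT.
  have := IH (rem (inr j) s) (rem j (b :: l)) srem urem.
  rewrite crem subn0 => /(_ (rem_uniq _ ul)) H.
  have {}H := H _; rewrite -[if b == j then _ else _]/(rem j (b :: l)).
  have -> : (if j \in b :: l then cb m u else cb m u.+1) =
      cb m (size (rem j (b :: l))).
    by case: ifP => jl; [rewrite size_rem|rewrite rem_id ?jl].
  apply: H => _ /mapP[k kl ->]; apply: inrem.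
    by apply: sub; rewrite map_f// (mem_rem kl).
  move: kl; rewrite (mem_rem_uniq j ul) inE => /andP[kj _].
  by apply: contra kj => /eqP[->].
rewrite [leRHS]big_seq; apply: le_trans (ler_sum _ bound).
rewrite -big_seq -big_distrr /= factS natrM [_ * (n`!)%:R]mulrC -mulrA ler_wpM2l//.
rewrite sum_if_count; last by case.
rewrite (count_live us ul sub) En /=.
(* The first servers of the third kind contribute multiples of [cb m u.+1], which cancel; what is
   left is the urn inequality. *)
have := core_bound_urn R m u; rewrite natrD -/cb; move: n.+1%:R => N.
lra.
Qed.

End Lossn.

Arguments is_core {A B}.
Arguments live {A B}.

(** * Single steps of RANKING on any instance *)

Section RankingFacts.
Variables (I : obm_instance) (R : realType) (y : server I -> R).
Implicit Types (M : {set server I * request I}) (r : request I) (s : server I).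

Lemma unmatched_add M s r : unmatched ((s, r) |: M) = unmatched M :\ s.
Proof.
apply/setP => t; rewrite !inE; apply/forallP/andP => [H|[ts /forallP H] r'].
  split; last by apply/forallP => r'; have := H r'; rewrite !inE negb_or => /andP[].
  by apply/eqP => ts; have := H r; rewrite !inE ts eqxx.
by rewrite !inE negb_or H andbT xpair_eqE (negbTE ts).
Qed.

Variant ranking_step_spec M r : {set server I * request I} -> Type :=
  | RankingStepMatch s of s \in neighbors r & s \in unmatched M :
      ranking_step_spec M r ((s, r) |: M)
  | RankingStepSkip : ranking_step_spec M r M.

Lemma ranking_stepP M r : ranking_step_spec M r (ranking_step y M r).
Proof.
rewrite /ranking_step /min_rank; case: pickP => [s|_]; last exact: RankingStepSkip.
by rewrite inE => /andP[/andP[sr sM] _]; exact: RankingStepMatch.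
Qed.

Lemma ranking_step_min M r s : s \in neighbors r -> s \in unmatched M ->
  (forall t, t \in neighbors r -> t \in unmatched M -> t != s -> y s < y t) ->
  ranking_step y M r = (s, r) |: M.
Proof.
move=> sr sM smin; rewrite /ranking_step /min_rank; case: pickP => [t|none].
  rewrite inE => /andP[/andP[tr tM] /forallP/(_ s)/implyP].
  rewrite inE sr sM => /(_ isT); have [-> //|ts] := eqVneq t s.
  by rewrite leNgt smin.
have /negP[] := negbT (none s); rewrite inE sr sM /=.
apply/forallP => t; apply/implyP; rewrite inE => /andP[tr tM].
by have [-> //|ts] := eqVneq t s; rewrite ltW// smin.
Qed.

(** A step that matches adds at most one edge and takes exactly one server out of the unmatched set,
    so the sum never grows along the fold. *)
Lemma card_ranking_unmatched :
  (#|ranking y| + #|unmatched (ranking y)| <= #|server I|)%N.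
Proof.
rewrite /ranking; set M := finset.set0.
have : (#|M| + #|unmatched M| <= #|server I|)%N by rewrite cards0 max_card.
elim: (arrival I) M => //= r l IH M hM; apply: IH.
case: (ranking_stepP M r) => // s _ sM.
rewrite unmatched_add cardsU1; rewrite (cardsD1 s (unmatched M)) sM in hM.
apply: leq_trans hM; rewrite addnA leq_add2r addnC leq_add2l.
exact: leq_b1.
Qed.

End RankingFacts.

(** * The hard regular instance and its perfect matching *)

Lemma perm_enum_sum (A B : finType) :
  perm_eq (map inl (enum A) ++ map inr (enum B)) (enum {: A + B}).
Proof.
apply: uniq_perm.
- rewrite cat_uniq; apply/and3P; split.
  + by rewrite map_inj_uniq ?enum_uniq// => a b [].
  + by apply/hasPn => _ /mapP[i _ ->]; apply/mapP => -[].
  + by rewrite map_inj_uniq ?enum_uniq// => a b [].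
- exact: enum_uniq.
move=> [i|i]; rewrite mem_enum inE mem_cat; apply/orP; [left|right];
by rewrite map_f// mem_enum.
Qed.

(* Servers: [inl _] is a core and [inr i] is p_i; requests: [inl i] is a_i. *)
Section HardInstance.
Variable n : nat.

Definition hard_adj (s : 'I_n + 'I_n.+1) (r : 'I_n.+1 + 'I_n) : bool :=
  match s, r with
  | inl _, inl _ => true
  | inl _, inr _ => false
  | inr i, inl j => i == j
  | inr _, inr _ => true
  end.

Definition hard_arrival : seq ('I_n.+1 + 'I_n) :=
  map inl (enum 'I_n.+1) ++ map inr (enum 'I_n).

Definition hard : obm_instance :=
  @ObmInstance ('I_n + 'I_n.+1)%type ('I_n.+1 + 'I_n)%type hard_adj hard_arrival
    (perm_enum_sum _ _).

Lemma card_hard_server : #|server hard| = (2 * n).+1.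
Proof. by rewrite card_sum !card_ord addnS mul2n addnn. Qed.

Lemma hard_regular : regular n.+1 hard.
Proof.
have cardL (A B : finType) : #|[set inl a | a : A] : {set A + B}| = #|A|.
  by rewrite card_imset ?cardsT// => a b [].
have cardR (A B : finType) : #|[set inr b | b : B] : {set A + B}| = #|B|.
  by rewrite card_imset ?cardsT// => a b [].
split=> [[c|i]|[i|j]].
- rewrite -[RHS]card_ord -(cardL _ 'I_n); apply: eq_card => -[i|j]; rewrite !inE.
    by rewrite imset_f.
  by apply/esym/imsetP => -[].
- rewrite (_ : [set r | _] = inl i |: [set inr b | b : 'I_n]); last first.
    apply/setP => -[j|j]; rewrite !inE /=; last by rewrite imset_f ?orbT.
    rewrite (_ : inl j \in _ = false) ?orbF; last by apply/imsetP => -[].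
    by rewrite eq_sym.
  rewrite cardsU1 cardR card_ord (_ : inl i \in _ = false)//.
  by apply/imsetP => -[].
- rewrite (_ : @neighbors hard _ = inr i |: [set inl c | c : 'I_n]); last first.
    apply/setP => -[j|j]; rewrite !inE /=; first by rewrite imset_f ?orbT.
    by rewrite (_ : inr j \in _ = false) ?orbF//; apply/imsetP => -[].
  rewrite cardsU1 cardL card_ord (_ : inr i \in _ = false)//.
  by apply/imsetP => -[].
- rewrite -[RHS]card_ord -(cardR 'I_n); apply: eq_card => -[i|i]; rewrite !inE.
    by apply/esym/imsetP => -[].
  by rewrite imset_f.
Qed.

(** A perfect matching: core c takes a_c, p_c takes the last request of index c for c < n, and p_n
    takes a_n, which the cores leave over. *)
Definition hard_partner (s : 'I_n + 'I_n.+1) : 'I_n.+1 + 'I_n :=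
  match s with
  | inl c => inl (lift ord_max c)
  | inr i => if unlift ord_max i is Some j then inr j else inl i
  end.

Lemma hard_partner_inj : injective hard_partner.
Proof.
move=> [c|i] [c'|i'] /=.
- by move=> [H]; congr inl; apply: (@lift_inj _ ord_max); exact: val_inj.
- case: unliftP => // -> [H].
  by have := neq_lift ord_max c; rewrite -(inj_eq val_inj) /= H eqxx.
- case: unliftP => // -> [H].
  by have := neq_lift ord_max c'; rewrite -(inj_eq val_inj) /= -H eqxx.
- by case: unliftP => [j|] ->; case: unliftP => [j'|] -> // [->].
Qed.

Lemma leq_hard_OPT : ((2 * n).+1 <= OPT hard)%N.
Proof.
pose M := [set (s : server hard, hard_partner s : request hard) | s : server hard].
have cM : #|M| = (2 * n).+1.
  by rewrite card_imset ?card_hard_server// => s t [].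
rewrite -cM /OPT; apply: leq_bigmax_cond.
apply/andP; split; apply/forallP => e; apply/implyP => /imsetP[s _ ->].
  case: s => [//|i] /=; by case: unliftP => //= _; rewrite eqxx.
apply/forallP => f; apply/implyP => /imsetP[t _ ->] /=; apply/implyP.
by move=> /orP[/eqP -> //|/eqP /hard_partner_inj ->].
Qed.

(** * RANKING on the hard instance, for a fixed strict order of the ranks *)

Section HardRanking.
Variables (R : realType) (y : server hard -> R) (o : seq ('I_n + 'I_n.+1)).
Hypothesis o_perm : perm_eq o (enum (server hard)).
Hypothesis o_sorted : sorted (fun s t => y s < y t) o.
Implicit Types (M : {set server hard * request hard}).

(** Only matched cores are dropped from the order. Matched private servers stay, being inert in
    [lossn] once their request has left the list. *)
Definition hard_free M : seq ('I_n + 'I_n.+1) :=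
  [seq s <- o | ~~ is_core s || (s \in unmatched M)].

Lemma mem_hard_free M s :
  (s \in hard_free M) = ~~ is_core s || (s \in unmatched M).
Proof. by rewrite mem_filter (perm_mem o_perm) mem_enum andbT. Qed.

Lemma hard_free_uniq M : uniq (hard_free M).
Proof. by rewrite filter_uniq// (perm_uniq o_perm) enum_uniq. Qed.

Lemma hard_free_sorted M : sorted (fun s t => y s < y t) (hard_free M).
Proof. by apply: sorted_filter o_sorted => a b c; exact: lt_trans. Qed.

Lemma hard_free_add M x r : hard_free ((x, r) |: M) =
  [seq s <- hard_free M | ~~ is_core s || (s != x)].
Proof.
rewrite -filter_predI; apply: eq_filter => s /=.
by rewrite unmatched_add in_setD1; case: is_core => //=.
Qed.

(** Induction on the requests: a_i goes to [x], the first server of [hard_free M] adjacent to it,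
    and the exchange lemmas remove a_i from [lossn] according to whether [x] is a core or p_i. *)
Lemma lossn_first_requests M l : uniq l ->
    (forall i, i \in l -> inr i \in unmatched M) ->
  lossn (hard_free M) l =
  count is_core (hard_free (foldl (ranking_step y) M (map inl l))).
Proof.
elim: l M => [|i l IH] M; first by rewrite lossn_nil.
move=> /= /andP[il ul] lM.
have iM : inr i \in unmatched M by rewrite lM// mem_head.
have lM' j : j \in l -> inr j \in unmatched M by move=> jl; rewrite lM// inE jl orbT.
(* p_i is still unmatched, so some server can take a_i. *)
have hasp : has (hard_adj^~ (inl i)) (hard_free M).
  by apply/hasP; exists (inr i); rewrite /= ?eqxx// mem_hard_free.
have : exists x s1 s2, [/\ hard_free M = s1 ++ x :: s2,
    hard_adj x (inl i) & ~~ has (hard_adj^~ (inl i)) s1].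
  by case: (split_find hasp) => x s1 s2 xi s1i; exists x, s1, s2; rewrite cat_rcons.
move=> [x] [s1] [s2] [E xi s1i].
(* [hard_free M] may hold matched private servers, but the only private server adjacent to a_i is
   p_i, which is unmatched. *)
have xM : x \in unmatched M.
  have : x \in hard_free M by rewrite E mem_cat mem_head orbT.
  by rewrite mem_hard_free; case: (x) xi => //= j /eqP ->; rewrite iM.
have s1c : ~~ has is_core s1.
  by apply: contra s1i; apply: sub_has => -[].
have is1 : inr i \notin s1.
  by apply: contra s1i => h; apply/hasP; exists (inr i) => /=.
have xs1 : x \notin s1.
  by apply: contra s1i => h; apply/hasP; exists x.
have xs2 : x \notin s2.
  by have := hard_free_uniq M; rewrite E cat_uniq /= => /and3P[_ _ /andP[]].
have step : ranking_step y M (inl i) = (x, inl i) |: M.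
  apply: ranking_step_min => //; first by rewrite inE.
  move=> t; rewrite inE => ti tM tx.
  have : t \in hard_free M by rewrite mem_hard_free tM orbT.
  rewrite E mem_cat inE (negbTE tx) /= => /orP[ts1|ts2].
    by case/negP: s1i; apply/hasP; exists t.
  have := hard_free_sorted M; rewrite E sorted_cat_cons => /andP[_].
  by move/(order_path_min (fun a b c => @lt_trans _ _ _ _ _))/allP; apply.
rewrite step -IH//; last first.
  move=> j jl; rewrite unmatched_add in_setD1 lM'// andbT.
  by apply: contraNneq il => jx; move: xi; rewrite -jx /= => /eqP <-.
rewrite hard_free_add E filter_cat /=.
have keep s' : x \notin s' -> [seq s <- s' | ~~ is_core s || (s != x)] = s'.
  move=> xs'; apply/all_filterP/allP => s ss'.
  by rewrite orbC; apply/orP; left; apply: contraNneq xs' => <-.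
rewrite !keep// eqxx orbF; case: (x) xi => [c _|j /eqP ->] /=.
  exact: lossn_cons_core.
exact: lossn_cons_live.
Qed.

(** The last requests see no core, so the loss of the first phase is final. *)
Lemma foldl_second_requests M (l : seq 'I_n) c :
  (inl c \in unmatched (foldl (ranking_step y) M (map inr l))) =
  (inl c \in unmatched M).
Proof.
elim: l M => //= j l IH M; rewrite IH; case: (ranking_stepP y M (inr j)) => //.
move=> s; rewrite inE => sj _; rewrite unmatched_add in_setD1.
by case: s sj.
Qed.

Lemma card_hard_ranking :
  (#|@ranking hard R y| + lossn o (enum 'I_n.+1) <= (2 * n).+1)%N.
Proof.
rewrite -card_hard_server; apply: leq_trans (card_ranking_unmatched y).
rewrite leq_add2l.
have un0 s : s \in unmatched (finset.set0 : {set server hard * request hard}).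
  by rewrite inE; apply/forallP => r; rewrite inE.
have -> : o = hard_free finset.set0.
  by apply/esym/all_filterP/allP => s _; rewrite un0 orbT.
rewrite lossn_first_requests ?enum_uniq//.
set M := foldl _ _ _; have EM : ranking y = foldl (ranking_step y) M (map inr (enum 'I_n)).
  by rewrite /ranking -foldl_cat.
rewrite EM -size_filter.
have /card_uniqP <- : uniq [seq s <- hard_free M | is_core s].
  by rewrite filter_uniq// hard_free_uniq.
apply: subset_leq_card; apply/fintype.subsetP => -[c|j]; rewrite mem_filter //=.
by rewrite mem_hard_free /= foldl_second_requests.
Qed.

End HardRanking.
End HardInstance.

(** * Bounding an expectation through disjoint events *)

Section Expectation.
Local Open Scope classical_set_scope.
Context (dT : measure_display) (T : measurableType dT) (R : realType).
Variable P : probability T R.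

(* Unlike [ge0_le_integral], this does not ask [f] and [g] to be measurable. *)
Lemma ge0_le_integral_setT (f g : T -> \bar R) :
  (forall x, 0 <= f x)%E -> (forall x, f x <= g x)%E ->
  (\int[P]_x f x <= \int[P]_x g x)%E.
Proof.
move=> f0 fg; rewrite !ge0_integralTE//; last by move=> x; exact: le_trans (fg x).
by apply: ereal_sup_le => _ [h hf <-]; exists h => // x; exact: le_trans (fg x).
Qed.

(** The measurable function c - g, where g is the sum of the a_j times the indicators of the E_j,
    dominates [X] because at most one term of g is nonzero at each point. Comparing with it covers
    an [X] whose measurability is not known. *)
Lemma expectation_le_events (J : eqType) (s : seq J) (E : J -> set T) (a : J -> R)
    (X : T -> R) (c p : R) :
  uniq s -> (forall j, measurable (E j)) -> (forall j, p%:E <= P (E j))%E ->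
  (forall j, 0 <= a j) ->
  (forall j k t, j \in s -> k \in s -> E j t -> E k t -> j = k) ->
  (forall t, 0 <= X t <= c) -> (forall j t, j \in s -> E j t -> X t + a j <= c) ->
  ('E_P[X] <= (c - p * \sum_(j <- s) a j)%:E)%E.
Proof.
move=> us mE pE a0 disj Xc XaE.
pose g t := \sum_(j <- s) a j * \1_(E j) t.
have g0 t : 0 <= g t by apply: sumr_ge0 => j _; rewrite mulr_ge0.
have Xg t : X t <= c - g t.
  rewrite lerBrDr /g; have [[j [js Ejt]]|none] := pselect (exists j, j \in s /\ E j t).
    rewrite (bigD1_seq j)//= big_seq_cond big1 ?addr0.
      by rewrite indicE mem_set// mulr1 XaE.
    move=> k /andP[ks kj]; rewrite indicE memNset ?mulr0// => Ekt.
    by rewrite (disj k j t)// eqxx in kj.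
  rewrite big_seq big1 ?addr0; first by case/andP: (Xc t).
  by move=> j js; rewrite indicE memNset ?mulr0// => Ejt; apply: none; exists j.
have mg : measurable_fun [set: T] g.
  by apply: measurable_sum => j; apply: measurable_funM.
have cg0 t : 0 <= c - g t by apply: le_trans (Xg t); case/andP: (Xc t).
have intg : (\int[P]_t (g t)%:E = \sum_(j <- s) (a j)%:E * P (E j))%E.
  transitivity (\int[P]_t (\sum_(j <- s) ((a j)%:E * (\1_(E j) t)%:E)))%E.
    by apply: eq_integral => t _; rewrite /g -sumEFin; apply: eq_bigr => j _; rewrite EFinM.
  rewrite ge0_integral_sum//; last 2 first.
  - move=> j; apply: measurable_funeM; apply/measurable_EFinP; exact: measurable_indic.
  - by move=> j t _; rewrite -EFinM lee_fin mulr_ge0.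
  apply: eq_bigr => j _; rewrite ge0_integralZl_EFin//.
    by rewrite integral_indic// setIT.
  exact/measurable_EFinP/measurable_indic.
(* The subtraction is done by adding two nonnegative integrals; their finite sum forces both to be
   finite. *)
have intcg : (\int[P]_t (c - g t)%:E + \int[P]_t (g t)%:E = c%:E)%E.
  rewrite -ge0_integralD//; first last.
  - exact/measurable_EFinP.
  - by move=> t _; rewrite lee_fin.
  - exact/measurable_EFinP/measurable_funB.
  - by move=> t _; rewrite lee_fin.
  rewrite (eq_integral (cst c%:E)); last by move=> t _; rewrite /= -EFinD subrK.
  by rewrite integral_cst//= probability_setT mule1.
have le_g : ((p * \sum_(j <- s) a j)%:E <= \int[P]_t (g t)%:E)%E.
  rewrite intg mulr_sumr -sumEFin; apply: lee_sum => j _.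
  by rewrite mulrC EFinM lee_wpmul2l// lee_fin.
rewrite unlock; apply: (@le_trans _ _ (\int[P]_t (c - g t)%:E)%E).
  by apply: ge0_le_integral_setT => t; rewrite lee_fin//; case/andP: (Xc t).
have i0 : (0 <= \int[P]_t (c - g t)%:E)%E by apply: integral_ge0 => t _; rewrite lee_fin.
move: intcg le_g i0; case: (\int[P]_t (c - g t)%:E)%E => [u| |]//.
  case: (\int[P]_t (g t)%:E)%E => [v| |]// [<-].
  by rewrite !lee_fin => h _; rewrite lerBrDr lerD2l.
by case: (\int[P]_t (g t)%:E)%E.
Qed.

End Expectation.

(** * Cells of the unit interval and boxes of ranks *)

Section Boxes.
Local Open Scope classical_set_scope.
Variable R : realType.
Implicit Types (N M : nat).

(** Half-open, so that cells of distinct indices are disjoint and strictly ordered. *)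
Definition cell M (k : nat) : set R := `[k%:R / M%:R, k.+1%:R / M%:R[.

Lemma uniform_prob_cell M (k : 'I_M) :
  uniform_prob (@ltr01 R) (cell M k) = (M%:R^-1)%:E.
Proof.
have M0 : 0 < M%:R :> R by rewrite ltr0n (leq_ltn_trans _ (ltn_ord k)).
rewrite /uniform_prob (eq_integral (cst 1%E)).
  rewrite integral_cst/=; last exact: measurable_itv.
  rewrite mul1e lebesgue_measure_itv/= lte_fin.
  rewrite ltr_pM2r ?invr_gt0// ltr_nat ltnSn -EFinB -mulrBl -natrB//.
  by rewrite subSn// subnn mul1r.
move=> x; rewrite inE /cell /= in_itv /= => /andP[kx xk].
rewrite /uniform_pdf subr0 invr1 ifT//; apply/andP; split.
  by apply: le_trans kx; rewrite divr_ge0.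
by rewrite (le_trans (ltW xk))// ler_pdivrMr// mul1r ler_nat.
Qed.

Lemma cell_lt M (j k : nat) (x y : R) : cell M j x -> cell M k y ->
  (j < k)%N -> x < y.
Proof.
rewrite /cell /= !in_itv /= => /andP[_ xj] /andP[ky _] jk.
apply: (lt_le_trans xj); apply: le_trans ky.
by rewrite ler_wpM2r ?invr_ge0// ler_nat.
Qed.

Lemma cell_inj M (j k : nat) (x : R) : cell M j x -> cell M k x -> j = k.
Proof.
move=> xj xk; case: (ltngtP j k) => // jk.
  by have := cell_lt xj xk jk; rewrite ltxx.
by have := cell_lt xk xj jk; rewrite ltxx.
Qed.

Definition box N M (k : 'I_N -> 'I_M) : set (N.-tuple (measurableTypeR R)) :=
  [set t | forall i, cell M (k i) (tnth t i)].

Lemma measurable_box N M (k : 'I_N -> 'I_M) : measurable (box k).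
Proof.
rewrite (_ : box k = \bigcap_(i in [set: 'I_N])
    ((fun t => tnth t i) @^-1` cell M (k i))).
  apply: fin_bigcap_measurable => // i _; rewrite -[X in measurable X]setTI.
  by apply: measurable_tnth => //; exact: measurable_itv.
by apply/seteqP; split => t /= h i => [_|]; exact: h.
Qed.

Lemma iid_uniform_cells N M (k : 'I_N -> 'I_M) :
  iid_uniform R N (box k) = (M%:R^-1 ^+ N)%:E.
Proof.
rewrite (iid_uniform_box (A := fun i => cell M (k i))); last first.
  by move=> i; exact: measurable_itv.
under eq_bigr do rewrite uniform_prob_cell.
by rewrite prodEFin prodr_const card_ord.
Qed.

End Boxes.

(** Each factor of the falling factorial is at least M - N, and Bernoulli's inequality bounds (1 -
    N/M)^N below by 1 - N^2/M. The error is explicit so that M can later grow. *)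
Lemma binomial_over_power (R : realFieldType) (N M : nat) : (0 < M)%N -> (N <= M)%N ->
  (N`!%:R)^-1 * (1 - (N * N)%:R / M%:R) <= 'C(M, N)%:R * M%:R^-1 ^+ N :> R.
Proof.
move=> M0 NM; have M0' : 0 < M%:R :> R by rewrite ltr0n.
rewrite mulrC ler_pdivrMr ?ltr0n ?fact_gt0//.
have -> : 'C(M, N)%:R * M%:R^-1 ^+ N * N`!%:R = (M ^_ N)%:R * M%:R^-1 ^+ N :> R.
  by rewrite -bin_ffact natrM; ring.
have ffact_ge : ((M - N) ^ N <= M ^_ N)%N.
  rewrite ffact_prod -[X in (_ ^ X)%N]card_ord -prod_nat_const.
  by apply: leq_prod => i _; rewrite leq_sub2l// ltnW.
apply: (@le_trans _ _ ((1 - N%:R / M%:R) ^+ N)).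
  rewrite natrM -mulrA; apply: bernoulli_le.
  by rewrite divr_ge0//= ler_pdivrMr// mul1r ler_nat.
have -> : 1 - N%:R / M%:R = (M - N)%:R / M%:R :> R.
  by rewrite natrB// mulrBl divff// gt_eqF.
by rewrite exprMn ler_wpM2r ?exprn_ge0 ?invr_ge0// -natrX ler_nat.
Qed.

Lemma le_archi_limit (R : archiRealFieldType) (x y b : R) (K : nat) :
  (forall M, (0 < M)%N -> (K <= M)%N -> x <= y + b / M%:R) -> x <= y.
Proof.
move=> h; apply/ler_addgt0Pr => e e0.
(* Large enough for b / M to be at most [e], and above the threshold [K]. *)
pose M := (Num.bound (`|b| / e) + K).+1.
apply: (le_trans (h M _ _)) => //; first by rewrite ltnW// ltnS leq_addl.
rewrite lerD2l ler_pdivrMr ?ltr0n// mulrC -ler_pdivrMr//.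
apply: (@le_trans _ _ (`|b| / e)); first by rewrite ler_pM2r ?invr_gt0// ler_norm.
have /archi_boundP/ltW/le_trans-> // : 0 <= `|b| / e by rewrite divr_ge0// ltW.
by rewrite ler_nat leqW// leq_addr.
Qed.

(** * Rank orders realised by boxes *)

Section OrderedRanks.
Local Open Scope classical_set_scope.
Variables (R : realType) (I : obm_instance).
Let N := #|server I|.

(** A pair (o, k) sends the j-th server of the order o to the j-th cell of k; [M0] is only the
    default of [nth]. *)
Definition order_cell M (ok : seq (server I) * N.-tuple 'I_M) (M0 : 'I_M) (i : 'I_N) : 'I_M :=
  nth M0 ok.2 (index (enum_val i) ok.1).

Lemma rank_of_box M (M0 : 'I_M) (ok : seq (server I) * N.-tuple 'I_M)
    (t : N.-tuple (measurableTypeR R)) :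
  perm_eq ok.1 (enum (server I)) -> sorted ltn (map val ok.2) ->
  box (order_cell ok M0) t ->
  sorted (fun r s => rank_of t r < rank_of t s) ok.1.
Proof.
case: ok => o k /= o_perm k_sorted tk.
have size_o : size o = N by rewrite (perm_size o_perm) -cardE.
have cell_o s j : (j < N)%N -> cell M (nth M0 k j) (rank_of t (nth s o j)).
  move=> jN; have := tk (enum_rank (nth s o j)); rewrite /order_cell enum_rankK /=.
  by rewrite index_uniq ?size_o// (perm_uniq o_perm) enum_uniq.
case: o size_o o_perm tk cell_o => // s o' size_o o_perm tk cell_o.
apply/(sortedP s) => j; rewrite size_o => jN.
apply: (cell_lt (cell_o s j (ltnW jN)) (cell_o s j.+1 jN)).
have /(sortedP 0%N)/(_ j) := k_sorted; rewrite size_map size_tuple => /(_ jN).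
by rewrite !(nth_map M0) ?size_tuple// ltnW.
Qed.

(** Boxes of distinct pairs are disjoint: a point determines the order, as the strictly sorted list
    of servers by rank, and then each cell, since cells are disjoint. *)
Lemma box_order_inj M (M0 : 'I_M) (ok1 ok2 : seq (server I) * N.-tuple 'I_M)
    (t : N.-tuple (measurableTypeR R)) :
  perm_eq ok1.1 (enum (server I)) -> sorted ltn (map val ok1.2) ->
  perm_eq ok2.1 (enum (server I)) -> sorted ltn (map val ok2.2) ->
  box (order_cell ok1 M0) t -> box (order_cell ok2 M0) t -> ok1 = ok2.
Proof.
move=> p1 s1 p2 s2 t1 t2.
have E1 : ok1.1 = ok2.1.
  apply: (irr_sorted_eq _ _ (rank_of_box p1 s1 t1) (rank_of_box p2 s2 t2)).
  - by move=> b a c; exact: lt_trans.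
  - by move=> a; rewrite ltxx.
  - by move=> s; rewrite (perm_mem p1) (perm_mem p2).
case: ok1 ok2 E1 p1 s1 p2 s2 t1 t2 => [u k1] [_ k2] /= <- p1 _ _ _ t1 t2.
congr (_, _); apply: eq_from_tnth => j; apply: val_inj.
have jo : (j < size u)%N by rewrite (perm_size p1) -cardE.
case: u p1 t1 t2 jo => // s u' p1 t1 t2 jo.
have ij : index (nth s (s :: u') j) (s :: u') = j.
  by rewrite index_uniq// (perm_uniq p1) enum_uniq.
have := t1 (enum_rank (nth s (s :: u') j)); have := t2 (enum_rank (nth s (s :: u') j)).
rewrite /order_cell enum_rankK ![index _ _]ij -!tnth_nth => h2 h1.
exact: cell_inj h1 h2.
Qed.

End OrderedRanks.

(** * Expected loss on the hard instance and the ratio *)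

(** For each M, the events are the boxes of all pairs of a server order and an increasing tuple of
    cells, with loss [lossn]. This gives the bound up to an error of order 1/M, which then
    vanishes. *)
Lemma expected_hard_ranking (R : realType) (n : nat) :
  (expected_ranking R (hard n) <= ((2 * n).+1%:R - core_bound R n n.+1)%:E)%E.
Proof.
rewrite /expected_ranking; set X := fun t => _.
set N := #|server (hard n)|; set l := enum 'I_n.+1; set cb := core_bound R n n.+1.
have NE : N = (2 * n).+1 by exact: card_hard_server.
have cb0 : 0 <= cb by rewrite mulr_ge0 ?exprn_ge0 ?divr_ge0.
have H M : (0 < M)%N -> (N <= M)%N -> ('E_(iid_uniform R N)[X] <=
    (N%:R - cb + (N * N)%:R * cb / M%:R)%:E)%E.
  move=> M0 NM; pose i0 := Ordinal M0.
  pose K := enum [set k : N.-tuple 'I_M | sorted ltn (map val k)].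
  pose os := permutations (enum (server (hard n))).
  pose s := [seq (o, k) | o <- os, k <- K].
  have ms ok : ok \in s ->
      perm_eq ok.1 (enum (server (hard n))) /\ sorted ltn (map val ok.2).
    move=> /allpairsP[[w k] /= [hw kK ->]].
    by move: hw kK; rewrite mem_permutations mem_enum inE.
  have := @expectation_le_events _ _ R (iid_uniform R N) _ s
    (fun ok => box (order_cell ok i0)) (fun ok => (lossn ok.1 l)%:R) X N%:R (M%:R^-1 ^+ N).
  move=> /(_ _ _ _ _ _ _ _)/le_trans; apply.
  - apply: allpairs_uniq; [exact: permutations_uniq|exact: enum_uniq|].
    by move=> [? ?] [? ?].
  - by move=> ok; exact: measurable_box.
  - by move=> ok; rewrite iid_uniform_cells.
  - by [].
  - move=> ok1 ok2 t /ms[? ?] /ms[? ?]; exact: box_order_inj.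
  - move=> t; rewrite ler0n ler_nat /=.
    by apply: leq_trans (card_ranking_unmatched _); exact: leq_addr.
  - move=> [w k] t /ms[/= o_perm k_sorted] tok.
    rewrite -natrD ler_nat NE; apply: card_hard_ranking => //.
    exact: (rank_of_box (ok := (w, k)) o_perm k_sorted tok).
  rewrite lee_fin -addrA lerD2l lerNl opprD opprK.
  (* The loss depends on the order alone, and each order comes with 'C(M, N) increasing tuples. *)
  have -> : \sum_(ok <- s) (lossn ok.1 l)%:R =
      'C(M, N)%:R * \sum_(w <- os) (lossn w l)%:R :> R.
    rewrite big_allpairs_dep /=.
    under eq_bigr do rewrite big_const_seq count_predT -cardE card_ltn_sorted_tuples
      iter_addr_0.
    by rewrite sumrMnl mulr_natl.
  rewrite [leRHS]mulrA [in leRHS](mulrC (_ ^+ N)).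
  have S : N`!%:R * cb <= \sum_(w <- os) (lossn w l)%:R.
    have sz_l : size l = n.+1 by rewrite /l size_enum_ord.
    have count_core : count is_core (enum (server (hard n))) = n.
      rewrite -(permP (perm_enum_sum 'I_n 'I_n.+1)) count_cat !count_map /=.
      rewrite (eq_count (a2 := predT))// count_predT (eq_count (a2 := pred0))// count_pred0.
      by rewrite addn0 -enumT size_enum_ord.
    have := @sum_lossn 'I_n 'I_n.+1 R (enum (server (hard n))) l.
    rewrite count_core sz_l -cardE; apply; rewrite ?enum_uniq// => x _.
    by rewrite mem_enum.
  have C0 : 0 <= 'C(M, N)%:R * M%:R^-1 ^+ N :> R by rewrite mulr_ge0 ?exprn_ge0 ?invr_ge0.
  apply: le_trans (ler_wpM2l C0 S).
  have Nf : 0 < N`!%:R :> R by rewrite ltr0n fact_gt0.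
  have NC := binomial_over_power R M0 NM.
  rewrite -(ler_pM2r Nf) mulrAC mulVf ?gt_eqF// mul1r in NC.
  rewrite [leRHS]mulrA; apply: le_trans (ler_wpM2r cb0 NC).
  by rewrite mulrBl mul1r; lra.
have E0 : (0 <= 'E_(iid_uniform R N)[X])%E by apply: expectation_ge0 => t; rewrite ler0n.
(* One admissible grid, here of N + 1 cells, already excludes an infinite expectation. *)
move: H E0; case: ('E_(iid_uniform R N)[X])%E => [e| |] H _ //; last first.
  by have := H N.+1 isT (leqnSn N); rewrite leye_eq.
rewrite lee_fin -NE; apply: (@le_archi_limit _ _ _ ((N * N)%:R * cb) N) => M M0 NM.
by rewrite -lee_fin H.
Qed.

Theorem theorem3p1 (R : realType) (d : nat) (hd : (2 <= d)%N) :
  (competitive_ratio (expected_ranking R) (regular d) <=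
   (1 - (d%:R - 1) / (2 * d%:R - 1) * (1 - 1 / d%:R) ^+ d)%:E)%E.
Proof.
case: d hd => // n _; have OPT_ge := leq_hard_OPT n.
apply: (@le_trans _ _ (expected_ranking R (hard n) * ((OPT (hard n))%:R^-1)%:E)%E).
  apply: ereal_inf_lbound; exists (hard n); split => //; first exact: hard_regular.
  exact: leq_trans OPT_ge.
have E0 : (0 <= expected_ranking R (hard n))%E.
  by apply: expectation_ge0 => t; rewrite ler0n.
have n0 : 0 <= n%:R :> R by [].
(* The expectation is nonnegative, so a lower bound on [OPT] suffices. *)
apply: (@le_trans _ _ (expected_ranking R (hard n) * ((2 * n).+1%:R^-1)%:E)%E).
  rewrite lee_wpmul2l// lee_fin lef_pV2 ?posrE ?ltr0n// ?ler_nat//.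
  exact: leq_trans OPT_ge.
have := expected_hard_ranking R n; set bound : R := _ - _ => E_le.
apply: (@le_trans _ _ (bound%:E * ((2 * n).+1%:R^-1)%:E)%E).
  by rewrite lee_wpmul2r// lee_fin invr_ge0.
rewrite -EFinM lee_fin /bound /core_bound -[(2 * n).+1%:R]natr1 natrM -[n.+1%:R]natr1.
clear E0 bound E_le.
(* With d = n + 1, the loss is (d-1) (1 - 1/d)^d and 2n + 1 = 2d - 1, so the two sides are equal. *)
have -> : 1 - 1 / (n%:R + 1) = n%:R / (n%:R + 1) :> R by field; lra.
move: (_ ^+ _) => q; rewrite le_eqVlt; apply/orP; left; apply/eqP.
by field; lra.
Qed.
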